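(* Let $g:U\times X\to X$ be a compactly driven system. Suppose there exists a surjective mapping $H:\overleftarrow{U}\to\overleftarrow{X}_U$, not assumed to be continuous, such that $\tilde g_v\circ H=H\circ\sigma_v$ for all $v\in U$. Then $H$ is discontinuous when $g$ does not have the unique solution property (USP).
   Context: A driven system consists of a metric space $(U,d_U)$, a compact metric space $(X,d)$ and a continuous map $g:U\times X\to X$. It is a compactly driven system if in addition $U$ is compact. Let $\overline{U}:=\prod_{i\in\mathbb{Z}}U$ and, for a space $Y$, $\overleftarrow{Y}:=\prod_{i=-\infty}^{-1}Y$, with product topologies. A solution for input $\bar u=\{u_n\}\in\overline{U}$ is a sequence $\{x_n\}_{n\in\mathbb{Z}}$ in $X$ with $x_{n+1}=g(u_n,x_n)$ for all $n\in\mathbb{Z}$. The system $g$ has the unique solution property (USP) if for each $\bar u\in\overline{U}$ there is exactly one solution. $\overleftarrow{X}_U$ denotes the space of left-infinite solutions, i.e. the set of all $(\ldots,x_{-2},x_{-1})\in\overleftarrow{X}$ that arise as left-infinite segments $(\ldots,x_{k-2},x_{k-1})$, $k\in\mathbb{Z}$, of solutions $\{x_n\}$ for inputs $\bar u\in\overline{U}$, with the topology inherited from the product topology. For $v\in U$, $\sigma_v:\overleftarrow{U}\to\overleftarrow{U}$ is $\sigma_v(\ldots,u_{-2},u_{-1})=(\ldots,u_{-2},u_{-1},v)$, and $\tilde g_v(\ldots,x_{-2},x_{-1})=(\ldots,x_{-2},x_{-1},g(v,x_{-1}))$, which maps $\overleftarrow{X}_U$ to itself. *)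

(* Defs.v *)
From mathcomp Require Export all_boot all_order all_algebra.
From mathcomp Require Export all_classical all_reals all_analysis.

Set Implicit Arguments.
Unset Strict Implicit.
Unset Printing Implicit Defensive.

Import Order.TTheory GRing.Theory Num.Theory.
Local Open Scope classical_set_scope.
Local Open Scope ring_scope.

(* Left-infinite sequences (..., y_{-2}, y_{-1}) with the product topology.
   The index j : nat stands for the negative integer -(j + 1), so that
   y 0 is the last entry y_{-1}. *)
Notation leftseq Y := {ptws nat -> Y}.

(* (..., y_{-2}, y_{-1}) |-> (..., y_{-2}, y_{-1}, v) *)
Definition append {Y : Type} (v : Y) (y : leftseq Y) : leftseq Y :=
  fun j => if j is j'.+1 then y j' else v.

Definition sigma {U : Type} (v : U) : leftseq U -> leftseq U := append v.

Definition solution {U X : Type} (g : U * X -> X)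
    (u : int -> U) (x : int -> X) : Prop :=
  forall n : int, x (n + 1) = g (u n, x n).

Definition USP {U X : Type} (g : U * X -> X) : Prop :=
  forall u : int -> U, exists! x : int -> X, solution g u x.

(* (..., x_{k-2}, x_{k-1}) *)
Definition left_segment {X : Type} (x : int -> X) (k : int) : leftseq X :=
  fun j => x (k - (j.+1)%:Z).

Definition left_solutions {U X : Type} (g : U * X -> X) : set (leftseq X) :=
  [set z | exists u x k, solution g u x /\ z = left_segment x k].

Definition extend {U X : Type} (g : U * X -> X) (v : U) (z : leftseq X) :
    leftseq X :=
  append (g (v, z 0%N)) z.

Lemma extend_left_solutions {U X : Type} (g : U * X -> X) (v : U)
    (z : leftseq X) :
  left_solutions g z -> left_solutions g (extend g v z).
Proof.
move=> [u [x [k [sol ->]]]].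
pose y := fix y m := if m is m'.+1 then g (u (k + m'%:Z), y m')
                     else g (v, x (k - 1)).
exists (fun n => if n == k - 1 then v else u n).
exists (fun n => if n - k is Posz m then y m else x n), (k + 1); split.
  move=> n /=; have [->|nk] := eqVneq n (k - 1).
    have -> : k - 1 + 1 - k = 0 by rewrite subrK subrr.
    by have -> : k - 1 - k = Negz 0 by rewrite addrAC subrr add0r.
  have En : n = k + (n - k) by rewrite addrC subrK.
  have -> : n + 1 - k = n - k + 1 by rewrite addrAC.
  case E : (n - k) => [m|[|m]].
  - by rewrite -PoszD addn1 /= {1}En E.
  - by move: nk; rewrite En E eqxx.
  - have -> : Negz m.+1 + 1 = Negz m.
      by rewrite !NegzE -[in m.+2]addn1 PoszD opprD addrNK.
    exact: sol.
apply: funext => -[|j]; rewrite /extend /left_segment /=.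
  by have -> : k + 1 - 1%:Z - k = 0 by rewrite addrK subrr.
have -> : k + 1 - (j.+2)%:Z = k - (j.+1)%:Z.
  by rewrite -[j.+2]add1n PoszD opprD addrA addrK.
by rewrite addrAC subrr add0r -NegzE.
Qed.

(* The restriction of extend g v to a self-map of the space of left-infinite
   solutions; the subtype [left_solutions g] carries the topology inherited
   from the product topology. *)
Definition gtilde {U X : Type} (g : U * X -> X) (v : U)
    (z : left_solutions g) : left_solutions g :=
  SigSub (mem_set (extend_left_solutions v (set_mem (valP z)))).

(* Main.v *)
Require Import Defs.

Set Implicit Arguments.
Unset Strict Implicit.
Unset Printing Implicit Defensive.

Import GRing.Theory.
Local Open Scope classical_set_scope.
Local Open Scope ring_scope.

(** Let [h w] be the last entry of the left-infinite solution [H w].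
    Equivariance says [h (append v w) = g (v, h w)], so reading [h] along the
    left segments of an input [u] gives a solution for [u]: solutions always
    exist, and failure of the USP means failure of uniqueness.

    Suppose now that [H] is continuous and let [x] be any solution for [u].
    For each [n], surjectivity gives a preimage of the segment of [x] ending
    [n] steps before time [k]; appending the last [n] letters of [u] to that
    preimage produces, by equivariance, a preimage of the segment of [x] ending
    at time [k] ([preimage_with_input_suffix]).  The preimages so obtained
    share longer and longer suffixes with the past of [u], hence converge to it
    in the product topology ([ptws_cvg_suffix]), while [h] takes the value
    [x k] on all of them.  By continuity [x k = h (left_segment u k)]: the
    solution is determined by its input, which is the USP. *)

Lemma left_segmentS {Y : Type} (u : int -> Y) (k : int) :
  left_segment u (k + 1) = append (u k) (left_segment u k).
Proof.
apply: funext => -[|j]; rewrite /left_segment /=; first by rewrite addrK.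
by rewrite -[j.+2]add1n PoszD opprD addrA addrK.
Qed.

(** The tails beyond the common suffix are arbitrary: each coordinate is
    eventually constant, and the product topology sees one coordinate at a
    time. *)
Lemma ptws_cvg_suffix {Y : uniformType} (w : nat -> leftseq Y)
    (z : leftseq Y) :
  (forall n j, (j < n)%N -> w n j = z j) -> w n @[n --> \oo] --> z.
Proof.
move=> wz; apply/pointwise_cvgP => j.
by apply: cvg_near_cst; exists j.+1 => // n; exact: wz.
Qed.

Definition last_state {U X : Type} {g : U * X -> X}
    (H : leftseq U -> left_solutions g) (w : leftseq U) : X :=
  (\val (H w) : leftseq X) 0%N.

Lemma continuous_last_state {U X : topologicalType} {g : U * X -> X}
    (H : leftseq U -> left_solutions g) :
  continuous H -> continuous (last_state H).
Proof.
move=> cH w.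
have cval : {for H w, continuous (set_val : left_solutions g -> leftseq X)}.
  exact: initial_continuous.
have cproj : {for set_val (H w),
    continuous (proj 0%N : leftseq X -> X)} by exact: proj_continuous.
have := continuous_comp (continuous_comp (cH w) cval) cproj.
by rewrite /comp /proj set_valE.
Qed.

Section Equivariant.
Context {U X : Type} {g : U * X -> X} (H : leftseq U -> left_solutions g).
Hypothesis equivariant_H : forall v : U, gtilde v \o H = H \o sigma v.

Lemma val_append (v : U) (w : leftseq U) :
  \val (H (append v w)) = extend g v (\val (H w)).
Proof. by have /(congr1 (fun f => \val (f w))) := equivariant_H v. Qed.

Lemma solution_last_state (u : int -> U) :
  solution g u (fun n => last_state H (left_segment u n)).
Proof. by move=> n; rewrite left_segmentS /last_state val_append. Qed.

(** Taking the preimage [n] steps in the past and driving it forward by [u]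
    forces its last [n] entries to be those of [u], although nothing relates
    the input of a left-infinite solution to its preimages under [H]. *)
Lemma preimage_with_input_suffix (u : int -> U) (x : int -> X) :
    set_surj [set: leftseq U] [set: left_solutions g] H -> solution g u x ->
  forall (n : nat) (k : int), exists w : leftseq U,
    \val (H w) = left_segment x (k + 1) /\
    forall j, (j < n)%N -> w j = left_segment u k j.
Proof.
move=> surjH solx; elim=> [|n IHn] k.
  have segP : left_solutions g (left_segment x (k + 1)) by exists u, x, (k + 1).
  have [w _ Hw] := surjH (SigSub (mem_set segP)) I.
  by exists w; rewrite Hw.
have [w [Hw wu]] := IHn (k - 1); rewrite subrK in Hw.
have uS := left_segmentS u (k - 1); rewrite subrK in uS.
exists (append (u (k - 1)) w); rewrite uS; split; last by case=> // j /wu.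
rewrite val_append Hw left_segmentS /extend; congr append.
by have := solx (k - 1); rewrite subrK => ->.
Qed.

End Equivariant.

Lemma solution_eq_last_state {U : uniformType} {X : topologicalType}
    {g : U * X -> X} (H : leftseq U -> left_solutions g)
    (u : int -> U) (x : int -> X) :
    hausdorff_space X ->
    set_surj [set: leftseq U] [set: left_solutions g] H ->
    (forall v : U, gtilde v \o H = H \o sigma v) ->
    continuous H -> solution g u x ->
  forall k : int, x k = last_state H (left_segment u k).
Proof.
move=> hX surjH eqH cH solx k.
have [w wP] := choice (fun n =>
  preimage_with_input_suffix eqH surjH solx n k).
have w_cvg : w n @[n --> \oo] --> (left_segment u k : leftseq U).
  by apply: ptws_cvg_suffix => n; case: (wP n).
have hw n : last_state H (w n) = x k.
  by rewrite /last_state (wP n).1 left_segmentS.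
have lim_h : last_state H (w n) @[n --> \oo] -->
    last_state H (left_segment u k).
  apply: continuous_cvg w_cvg; exact: continuous_last_state.
apply: (cvg_unique hX _ lim_h).
by apply: cvg_near_cst; exact: nearW.
Qed.

Theorem proposition1 (R : realType) (U X : metricType R) (g : U * X -> X)
    (compactU : compact [set: U]) (compactX : compact [set: X])
    (continuous_g : continuous g)
    (H : leftseq U -> left_solutions g)
    (surjective_H : set_surj [set: leftseq U] [set: left_solutions g] H)
    (equivariant_H : forall v : U, gtilde v \o H = H \o sigma v) :
  ~ USP g -> ~ continuous H.
Proof.
move=> nUSP cH; apply: nUSP => u.
exists (fun n => last_state H (left_segment u n)); split.
  exact: solution_last_state.
move=> x solx; apply: funext => k; apply/esym.
exact: (solution_eq_last_state (@metric_hausdorff R X) surjective_H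
          equivariant_H cH solx).
Qed.
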